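(* Let $\Omega$ be a linear functional on $\mathbb{C}_{2N}[\lambda]$ which is the generalized spectral function of some complex Jacobi matrix of size $N\times N$. Then there are precisely $2^{N-1}$ distinct complex Jacobi matrices of size $N\times N$ whose generalized spectral function is $\Omega$. Moreover, for every such matrix the squares $\alpha_n^2$ ($1\le n\le N-1$) of the leading coefficients $\alpha_n$ of the polynomials $P_n$ are determined by $\Omega$ alone; and if for each $n\in\{1,\dots,N-1\}$ one of the two square roots of the number $\alpha_n^2$ so determined is labelled $+$ and the other $-$, then for every sequence of signs $\{\sigma_1,\dots,\sigma_{N-1}\}$, $\sigma_n\in\{+,-\}$, there is exactly one complex Jacobi matrix with generalized spectral function $\Omega$ for which, for each $n\in\{1,\dots,N-1\}$, $\alpha_n$ is the square root labelled $\sigma_n$.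
   Context: $N$ is a positive integer. A complex Jacobi matrix $J$ of size $N\times N$ here is a symmetric tridiagonal matrix (rows and columns indexed $0,\dots,N-1$) with diagonal entries $b_0,\dots,b_{N-1}\in\mathbb{C}$, with nonzero entries $a_n\in\mathbb{C}$ in positions $(n,n+1)$ and $(n+1,n)$ for $0\le n\le N-2$, and zeros elsewhere. Put $a_{N-1}=1$. The polynomials $P_0(\lambda),\dots,P_N(\lambda)$ associated with $J$ are defined by $P_0(\lambda)=1$, $b_0P_0(\lambda)+a_0P_1(\lambda)=\lambda P_0(\lambda)$, $a_{n-1}P_{n-1}(\lambda)+b_nP_n(\lambda)+a_nP_{n+1}(\lambda)=\lambda P_n(\lambda)$ for $n\in\{1,\dots,N-1\}$. $P_n$ has degree $n$, and $\alpha_n\neq 0$ denotes its leading coefficient. $\mathbb{C}_m[\lambda]$ is the space of polynomials of degree $\le m$ with complex coefficients; $\langle\Omega,G(\lambda)\rangle$ denotes the value of the linear functional $\Omega$ at $G$. The generalized spectral function of $J$ is the unique linear functional $\Omega:\mathbb{C}_{2N}[\lambda]\to\mathbb{C}$ such that $\langle\Omega,P_mP_n\rangle=\delta_{mn}$ for $m,n\in\{0,\dots,N-1\}$ and $\langle\Omega,P_mP_N\rangle=0$ for $m\in\{0,\dots,N\}$. *)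

(* Defs.v *)
From mathcomp Require Import all_boot all_order all_algebra.
From mathcomp Require Import zify complex.

Set Implicit Arguments.
Unset Strict Implicit.
Unset Printing Implicit Defensive.

Import Order.TTheory GRing.Theory Num.Theory.
Local Open Scope ring_scope.

Section Jacobi.
Variables (F : fieldType) (N : nat).
Implicit Types (J : 'M[F]_N) (m n : nat).

Definition is_jacobi J : Prop :=
  [/\ J^T = J,
      forall i j : 'I_N, (i.+1 < j)%N -> J i j = 0
    & forall i j : 'I_N, j = i.+1 :> nat -> J i j != 0].

(* The entry of J in position (m, n), with indices in nat; 0 out of range. *)
Definition entry J m n : F :=
  if (insub m : option 'I_N, insub n : option 'I_N) is (Some i, Some j)
  then J i j else 0.

Definition jac_b J n : F := entry J n n.

(* The convention a_(N-1) = 1 is built in. *)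
Definition jac_a J n : F := if (n.+1 < N)%N then entry J n n.+1 else 1.

(* The pair (P_(n-1), P_n), with P_(-1) = 0, obtained by solving the
   three-term recurrence for its last term; see jpoly_rec0 and jpoly_recS. *)
Fixpoint jpoly_pair J n : {poly F} * {poly F} :=
  if n is m.+1 then
    let: (p, q) := jpoly_pair J m in
    (q, (jac_a J m)^-1 *: (('X - (jac_b J m)%:P) * q - jac_a J m.-1 *: p))
  else (0, 1).

(* Only P_0, ..., P_N are meaningful. *)
Definition jpoly J n : {poly F} := (jpoly_pair J n).2.

(* {poly_(N.*2.+1) F} is the space of polynomials of degree at most 2N.  The
   truncation npolyp leaves P_m P_n unchanged whenever m, n <= N
   (see jpolyM_npolyp).  At most one functional satisfies these conditions when
   J is a Jacobi matrix (see is_gsf_unique). *)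
Definition is_gsf J (Omega : {scalar {poly_(N.*2.+1) F}}) : Prop :=
  (forall m n, (m < N)%N -> (n < N)%N ->
     Omega (npolyp N.*2.+1 (jpoly J m * jpoly J n)) = (m == n)%:R) /\
  (forall m, (m <= N)%N ->
     Omega (npolyp N.*2.+1 (jpoly J m * jpoly J N)) = 0).

Lemma jac_a_neq0 J n : is_jacobi J -> jac_a J n != 0.
Proof.
case=> _ _ nz; rewrite /jac_a; case: ifP => [lt|_]; last exact: oner_neq0.
by rewrite /entry (insubT (fun k => k < N)%N (ltnW lt)) (insubT (fun k => k < N)%N lt) nz.
Qed.

Lemma jpoly0 J : jpoly J 0 = 1. Proof. by []. Qed.

Lemma jpoly_rec0 J : is_jacobi J ->
  jac_b J 0 *: jpoly J 0 + jac_a J 0 *: jpoly J 1 = 'X * jpoly J 0.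
Proof.
move=> /(@jac_a_neq0 _ 0) nz; rewrite /jpoly /= scaler0 subr0 !mulr1.
by rewrite [jac_a J 0 *: _]scalerA mulfV // scale1r alg_polyC addrC subrK.
Qed.

Lemma jpoly_recS J n : is_jacobi J ->
  jac_a J n *: jpoly J n + jac_b J n.+1 *: jpoly J n.+1
    + jac_a J n.+1 *: jpoly J n.+2 = 'X * jpoly J n.+1.
Proof.
move=> /(@jac_a_neq0 _ n.+1) nz; rewrite /jpoly /=.
case: (jpoly_pair J n) => p q /=.
set s := _^-1 *: (_ - _ *: p); rewrite [jac_a J n.+1 *: _]scalerA mulfV // scale1r mulrBl.
by rewrite mul_polyC addrC addrA !subrK.
Qed.

Lemma size_jpoly J n : is_jacobi J -> size (jpoly J n) = n.+1.
Proof.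
move=> HJ; elim/ltn_ind: n => -[_|[_|n IH]].
- by rewrite jpoly0 size_poly1.
- rewrite /jpoly /= scaler0 subr0 mulr1 size_scale ?size_XsubC //.
  by rewrite invr_eq0 jac_a_neq0.
have := IH n (leqW (leqnn _)); have := IH n.+1 (leqnn _); rewrite /jpoly /=.
case: (jpoly_pair J n) => p q /=; set s := _^-1 *: (_ - _ *: p) => ss sq.
rewrite size_scale ?invr_eq0 ?jac_a_neq0 //.
have s0 : s != 0 by rewrite -size_poly_gt0 ss.
have sXs : size (('X - (jac_b J n.+1)%:P) * s) = n.+3.
  by rewrite size_monicM ?monicXsubC // size_XsubC ss.
by rewrite size_polyDl // size_polyN sXs (leq_ltn_trans (size_scale_leq _ _)) // sq.
Qed.

Lemma size_jpolyM J m n : is_jacobi J ->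
  size (jpoly J m * jpoly J n) = (m + n).+1.
Proof.
move=> HJ; rewrite size_mul -?size_poly_gt0 ?size_jpoly //.
by rewrite addSn addnS.
Qed.

Lemma jpolyM_npolyp J m n : is_jacobi J -> (m <= N)%N -> (n <= N)%N ->
  npolyp N.*2.+1 (jpoly J m * jpoly J n) = jpoly J m * jpoly J n :> {poly F}.
Proof.
move=> HJ mN nN; apply: npolypK.
by rewrite size_jpolyM // ltnS -addnn leq_add.
Qed.

Lemma is_gsf_unique J (Omega1 Omega2 : {scalar {poly_(N.*2.+1) F}}) :
  is_jacobi J -> is_gsf J Omega1 -> is_gsf J Omega2 -> Omega1 =1 Omega2.
Proof.
move=> HJ [A1 B1] [A2 B2] G.
have [k] := ubnP (size (G : {poly F})); elim: k G => // k IH G.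
rewrite ltnS => Gk; have [G0|Gn0] := eqVneq (size (G : {poly F})) 0%N.
  have -> : G = 0 by apply: val_inj; apply/eqP; rewrite -size_poly_eq0 G0.
  by rewrite !linear0.
set d := (size (G : {poly F})).-1.
have dE : size (G : {poly F}) = d.+1 by rewrite prednK // lt0n.
have dN : (d <= N.*2)%N by rewrite -ltnS -dE; exact: size_npoly.
pose n := minn d N; pose m := (d - n)%N.
have mnd : (m + n)%N = d by rewrite subnK // geq_minl.
have nN : (n <= N)%N by rewrite geq_minr.
have mN : (m <= N)%N.
  by rewrite /m leq_subLR /n minnE; move: dN; rewrite -addnn; case: leqP; lia.
pose H := npolyp N.*2.+1 (jpoly J m * jpoly J n).
have HE : H = jpoly J m * jpoly J n :> {poly F} by exact: jpolyM_npolyp.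
have O12 : Omega1 H = Omega2 H.
  have [nlt|nge] := ltnP n N; last first.
    have -> : H = npolyp N.*2.+1 (jpoly J m * jpoly J N).
      by rewrite /H; congr (npolyp _ (_ * jpoly J _)); apply/eqP; rewrite eqn_leq nN.
    by rewrite B1 ?B2.
  have mlt : (m < N)%N by move: nlt; rewrite /m /n; lia.
  by rewrite A1 ?A2.
have sH : size (H : {poly F}) = d.+1 by rewrite HE size_jpolyM // mnd.
have lH : (H : {poly F})`_d != 0.
  by rewrite -[d]/(d.+1.-1) -sH -lead_coefE lead_coef_eq0 -size_poly_gt0 sH.
pose c := (G : {poly F})`_d / (H : {poly F})`_d.
suff E : Omega1 (G - c *: H) = Omega2 (G - c *: H).
  by move: E; rewrite !linearB !linearZ /= O12 => /addIr.
apply: IH; apply: (leq_trans _ Gk); rewrite dE ltnS; apply/leq_sizeP => j.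
rewrite leq_eqVlt => /orP[/eqP<-|dj] /=.
  by rewrite coefB coefZ /c divfK // subrr.
by rewrite coefB coefZ !nth_default ?mulr0 ?subr0 // ?sH ?dE.
Qed.

End Jacobi.

(* Main.v *)
Require Import Defs.
From HB Require Import structures.
From mathcomp Require Import all_boot all_order all_algebra.
From mathcomp Require Import complex zify ring.
From mathcomp Require Import all_classical all_reals.

Set Implicit Arguments.
Unset Strict Implicit.
Unset Printing Implicit Defensive.

Import Order.TTheory GRing.Theory Num.Theory.
Local Open Scope classical_set_scope.
Local Open Scope card_scope.
Local Open Scope ring_scope.

(* A generalized spectral function determines its Jacobi matrices up to signs.
   Indeed b_n = <Omega, X P_n^2> and a_n = <Omega, X P_n P_(n+1)>, so, going up
   the three-term recurrence, P_0, ..., P_n determine b_n and the polynomial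
   a_n P_(n+1), whose square has Omega-value a_n^2.  Hence two matrices with the
   same Omega satisfy K = D J D with D = diag(1, s_1, ..., s_(N-1)), s_n = +-1;
   conversely, J and D J D always have the same Omega, and conjugation by D
   multiplies the leading coefficient of P_n by s_n. *)

(** Registered as an instance so that linearity passes through the truncation inside [Omega]. *)
Lemma npolyp_is_linear (F : fieldType) n : linear (@npolyp F n).
Proof.
move=> c p q; apply/val_inj/polyP => i.
rewrite /= coefD coefZ !coef_npolyp coefD coefZ.
by case: ifP => // _; rewrite mulr0 addr0.
Qed.

HB.instance Definition _ (F : fieldType) n :=
  GRing.isLinear.Build F {poly F} {poly_n F} _ (@npolyp F n)
    (@npolyp_is_linear F n).

(** * Matrix entries and the three-term recurrence *)

Section Entries.
Variables (F : fieldType) (N : nat).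
Implicit Types (J K : 'M[F]_N) (m n : nat).

Lemma entryE J (i j : 'I_N) : entry J i j = J i j.
Proof. by rewrite /entry !valK. Qed.

Lemma jac_bE J (i : 'I_N) : jac_b J i = J i i.
Proof. exact: entryE. Qed.

Lemma jac_aE J (i j : 'I_N) : j = i.+1 :> nat -> jac_a J i = J i j.
Proof. by move=> ji; rewrite /jac_a -ji ltn_ord entryE. Qed.

Lemma jacobi_inj J K : is_jacobi J -> is_jacobi K ->
  (forall n, (n < N)%N -> jac_b J n = jac_b K n) ->
  (forall n, (n.+1 < N)%N -> jac_a J n = jac_a K n) -> J = K.
Proof.
move=> [JT J0 _] [KT K0 _] eqb eqa.
have le (i j : 'I_N) : (i <= j)%N -> J i j = K i j.
  rewrite leq_eqVlt => /orP[/eqP/val_inj <-|]; first by rewrite -!jac_bE eqb.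
  rewrite leq_eqVlt => /orP[/eqP ij|lt]; last by rewrite J0 ?K0.
  by rewrite -!(jac_aE _ (esym ij)) eqa // ij.
apply/matrixP => i j; have [/le//|/ltnW/le] := leqP i j.
by rewrite -{2}JT -{2}KT !mxE.
Qed.

(** The conditional stands for a_(n-1) P_(n-1), zero at n = 0, so that one formula covers both
    recurrences. *)
Lemma jpolyS_rec J n : is_jacobi J -> jac_a J n *: jpoly J n.+1 =
  'X * jpoly J n - jac_b J n *: jpoly J n
    - (if n is m.+1 then jac_a J m *: jpoly J m else 0).
Proof.
case: n => [|n] HJ; first by rewrite -(jpoly_rec0 HJ) subr0 [X in X - _]addrC addrK.
by rewrite -(jpoly_recS n HJ) addrAC -addrA -opprD addrAC subrr add0r.
Qed.

Lemma lead_jpoly_neq0 J n : is_jacobi J -> lead_coef (jpoly J n) != 0.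
Proof. by move=> HJ; rewrite lead_coef_eq0 -size_poly_gt0 size_jpoly. Qed.

End Entries.

(** * Conjugation by a diagonal matrix of signs *)

Section SignChange.
Variables (F : fieldType) (N : nat).
Implicit Types (J K : 'M[F]_N) (m n : nat).

(** The product D J D with D = diag(s); [s] is indexed by nat because P_N needs a sign as well. *)
Definition sign_conj (s : nat -> F) J : 'M[F]_N :=
  \matrix_(i, j) (s i * s j * J i j).

Variable s : nat -> F.
Hypotheses (s0 : s 0 = 1) (s_sqr : forall n, s n ^+ 2 = 1).
(* Constancy from N - 1 on makes jpoly_sign_conj hold for P_N as well. *)
Hypothesis s_const : forall n, (N <= n.+1)%N -> s n.+1 = s n.

Let s_mul n : s n * s n = 1. Proof. exact: s_sqr. Qed.

Let s_neq0 n : s n != 0.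
Proof.
by apply/eqP => sn; move/eqP: (s_mul n); rewrite sn mul0r eq_sym oner_eq0.
Qed.

Lemma sign_conj_jacobi J : is_jacobi J -> is_jacobi (sign_conj s J).
Proof.
case=> JT J0 Jn; split.
- by apply/matrixP => i j; rewrite !mxE -{1}JT mxE [s j * _]mulrC.
- by move=> i j /J0 ij; rewrite mxE ij mulr0.
- by move=> i j /Jn ij; rewrite mxE !mulf_neq0.
Qed.

Lemma entry_sign_conj J m n : entry (sign_conj s J) m n = s m * s n * entry J m n.
Proof.
rewrite /entry; case: insubP => [i _ <-|_]; last by rewrite mulr0.
by case: insubP => [j _ <-|_]; rewrite ?mxE ?mulr0.
Qed.

Lemma jac_b_sign_conj J n : jac_b (sign_conj s J) n = jac_b J n.
Proof. by rewrite /jac_b entry_sign_conj s_mul mul1r. Qed.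

Lemma jac_a_sign_conj J n :
  jac_a (sign_conj s J) n = s n * s n.+1 * jac_a J n.
Proof.
rewrite /jac_a entry_sign_conj; case: ltnP => // Nn.
(* From n = N - 1 on, a_n is 1 for both matrices, so s_n s_(n+1) has to be 1. *)
by rewrite s_const // s_mul mulr1.
Qed.

(** Put s_n P_n into the recurrence of D J D: since signs square to 1, each term becomes s_n times
    the one for J. *)
Lemma jpoly_sign_conj J n : jpoly (sign_conj s J) n = s n *: jpoly J n.
Proof.
suff: jpoly_pair (sign_conj s J) n =
    (s n.-1 *: (jpoly_pair J n).1, s n *: (jpoly_pair J n).2).
  by rewrite /jpoly => ->.
elim: n => [|n IH] /=; first by rewrite s0 scaler0 scale1r.
rewrite IH jac_b_sign_conj.
have -> : jac_a (sign_conj s J) n.-1 *: (s n.-1 *: (jpoly_pair J n).1) =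
    s n *: (jac_a J n.-1 *: (jpoly_pair J n).1).
  (* At n = 0 the truncated index [n.-1] is harmless, since P_(-1) = 0. *)
  case: n {IH} => [|n] /=; first by rewrite !scaler0.
  rewrite jac_a_sign_conj !scalerA; congr (_ *: _).
  by rewrite -[RHS]mul1r -(s_mul n); ring.
case: (jpoly_pair J n) => p q /=; congr (_, _).
rewrite -scalerAr -scalerBr !scalerA; congr (_ *: _).
rewrite jac_a_sign_conj !invfM mulrAC; congr (_ * _); rewrite mulrAC mulVf // mul1r.
by apply: (mulIf (s_neq0 n.+1)); rewrite mulVf.
Qed.

Lemma sign_conj_gsf J Omega : is_gsf J Omega -> is_gsf (sign_conj s J) Omega.
Proof.
case=> A B; split=> m; last first.
  move=> mN; rewrite !jpoly_sign_conj -scalerAl -scalerAr !linearZ /= B //.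
  by rewrite !mulr0.
move=> n mN nN; rewrite !jpoly_sign_conj -scalerAl -scalerAr !linearZ /= A //.
by have [->|_] := eqVneq m n; rewrite ?mulr1 ?s_mul ?mulr0.
Qed.

End SignChange.

(** * Recovering the matrix from its spectral function *)

Section Gsf.
Variables (F : fieldType) (N : nat) (Omega : {scalar {poly_(N.*2.+1) F}}).
Implicit Types (J K : 'M[F]_N) (m n : nat).

(** The products evaluated below have degree at most 2N, so the truncation does not alter them. *)
Let E (p : {poly F}) : F := Omega (npolyp N.*2.+1 p).

Let ED p q : E (p + q) = E p + E q. Proof. by rewrite /E !linearD. Qed.
Let EZ c p : E (c *: p) = c * E p. Proof. by rewrite /E !linearZ. Qed.

(** The case m = N is included because X P_(N-1) involves P_N. *)
Lemma gsf_orthonormal J m n : is_gsf J Omega -> (m <= N)%N -> (n < N)%N ->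
  E (jpoly J m * jpoly J n) = (m == n)%:R.
Proof.
case=> A B; rewrite leq_eqVlt => /orP[/eqP->|mN] nN; last exact: A.
by rewrite mulrC /E B 1?ltnW // gtn_eqF.
Qed.

Lemma gsf_XM J n k : is_jacobi J -> is_gsf J Omega -> (n < N)%N -> (k < N)%N ->
  E ('X * jpoly J n * jpoly J k) =
  jac_a J n * (n.+1 == k)%:R + jac_b J n * (n == k)%:R
    + (if n is m.+1 then jac_a J m * (m == k)%:R else 0).
Proof.
move=> HJ HO nN kN.
have -> : 'X * jpoly J n = jac_a J n *: jpoly J n.+1 + jac_b J n *: jpoly J n
    + (if n is m.+1 then jac_a J m *: jpoly J m else 0).
  by rewrite jpolyS_rec // addrAC !subrK.
rewrite !mulrDl !ED -!scalerAl !EZ !gsf_orthonormal ?(ltnW nN) //; congr (_ + _).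
case: n nN => [|m] mN; first by rewrite mul0r /E !linear0.
by rewrite -scalerAl EZ gsf_orthonormal // ltnW // ltnW.
Qed.

Lemma gsf_jac_b J n : is_jacobi J -> is_gsf J Omega -> (n < N)%N ->
  jac_b J n = E ('X * jpoly J n * jpoly J n).
Proof.
move=> HJ HO nN; rewrite gsf_XM // eqxx mulr1 gtn_eqF // mulr0 add0r.
by case: n {nN} => [|n]; rewrite ?addr0 // ltn_eqF // mulr0 addr0.
Qed.

Lemma gsf_jac_a J n : is_jacobi J -> is_gsf J Omega -> (n.+1 < N)%N ->
  jac_a J n = E ('X * jpoly J n * jpoly J n.+1).
Proof.
move=> HJ HO nN; rewrite gsf_XM ?(ltnW nN) // eqxx mulr1 ltn_eqF // mulr0 addr0.
by case: n {nN} => [|n]; rewrite ?addr0 // ltn_eqF ?mulr0 ?addr0.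
Qed.

(** The induction is strong because the recurrence involves two earlier polynomials, whose signs c
    and d are unrelated. *)
Lemma gsf_jpoly_sign J K n : is_jacobi J -> is_gsf J Omega ->
  is_jacobi K -> is_gsf K Omega -> (n < N)%N ->
  exists2 c, c ^+ 2 = 1 & jpoly K n = c *: jpoly J n.
Proof.
move=> HJ OJ HK OK; elim/ltn_ind: n => -[|n] IH nN.
  by exists 1; rewrite ?expr1n // !jpoly0 scale1r.
have nN' := ltnW nN.
have [c c2 PE] := IH n (leqnn _) nN'.
have bE : jac_b K n = jac_b J n.
  rewrite !gsf_jac_b // PE -!scalerAr -!scalerAl !EZ mulrA.
  by rewrite -[c * c]/(c ^+ 2) c2 mul1r.
(* For n = m + 1, a_m changes by the factor c d and P_m by d, so the term changes by c d^2 = c. *)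
have prevE : (if n is m.+1 then jac_a K m *: jpoly K m else 0) =
    c *: (if n is m.+1 then jac_a J m *: jpoly J m else 0).
  case: n IH PE {bE nN} nN' => [|m] IH PE mN; first by rewrite scaler0.
  have [d d2 QE] := IH m (leqW (leqnn _)) (ltnW mN).
  rewrite gsf_jac_a // PE QE -!scalerAr -!scalerAl !EZ -gsf_jac_a // !scalerA.
  congr (_ *: _); rewrite -[RHS]mulr1 -d2; ring.
have aPE : jac_a K n *: jpoly K n.+1 = c *: (jac_a J n *: jpoly J n.+1).
  rewrite !jpolyS_rec // bE prevE PE -scalerAr !scalerBr !scalerA.
  by rewrite [c * _]mulrC.
have aK0 := jac_a_neq0 n HK.
(* Apply [Omega] to the square of [aPE]: as n + 1 < N, both P_(n+1) have norm 1, whereas P_N would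
   have norm 0. *)
have a2 : jac_a K n ^+ 2 = jac_a J n ^+ 2.
  have : E (jac_a K n *: jpoly K n.+1 * (jac_a K n *: jpoly K n.+1)) =
         E (c *: (jac_a J n *: jpoly J n.+1) * (c *: (jac_a J n *: jpoly J n.+1))).
    by rewrite aPE.
  rewrite -!scalerAr -!scalerAl !EZ !gsf_orthonormal ?(ltnW nN) // eqxx !mulr1.
  by move=> aa; rewrite expr2 aa -[RHS]mul1r -c2; ring.
exists ((jac_a K n)^-1 * (c * jac_a J n)).
  by rewrite !exprMn c2 mul1r -a2 -exprMn mulVf // expr1n.
by rewrite -scalerA -[in RHS]scalerA -aPE scalerA mulVf // scale1r.
Qed.

Lemma gsf_lead_sqr J K n : is_jacobi J -> is_gsf J Omega ->
  is_jacobi K -> is_gsf K Omega -> (n < N)%N ->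
  lead_coef (jpoly K n) ^+ 2 = lead_coef (jpoly J n) ^+ 2.
Proof.
move=> HJ OJ HK OK nN; have [c c2 ->] := gsf_jpoly_sign HJ OJ HK OK nN.
by rewrite lead_coefZ exprMn c2 mul1r.
Qed.

(** Equal leading coefficients force each sign of [gsf_jpoly_sign] to be 1; the polynomials then
    give the entries through [Omega]. *)
Lemma gsf_lead_inj J K : is_jacobi J -> is_gsf J Omega ->
  is_jacobi K -> is_gsf K Omega ->
  (forall n, (1 <= n <= N - 1)%N ->
     lead_coef (jpoly J n) = lead_coef (jpoly K n)) -> J = K.
Proof.
move=> HJ OJ HK OK eq_lead.
have eqP n : (n < N)%N -> jpoly J n = jpoly K n.
  case: n => [|n] nN; first by rewrite !jpoly0.
  have [c _ PE] := gsf_jpoly_sign HJ OJ HK OK nN; rewrite PE.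
  have nN1 : (1 <= n.+1 <= N - 1)%N by lia.
  have := eq_lead _ nN1; rewrite PE lead_coefZ => /esym c1.
  suff -> : c = 1 by rewrite scale1r.
  by apply: (mulIf (lead_jpoly_neq0 n.+1 HJ)); rewrite c1 mul1r.
apply: jacobi_inj => // n nN; first by rewrite !gsf_jac_b // eqP.
by rewrite !gsf_jac_a // !eqP // ltnW.
Qed.

Lemma gsf_lead_exists J (r : nat -> F) : is_jacobi J -> is_gsf J Omega ->
  (forall n, (1 <= n <= N - 1)%N -> r n ^+ 2 = lead_coef (jpoly J n) ^+ 2) ->
  exists K, [/\ is_jacobi K, is_gsf K Omega
    & forall n, (1 <= n <= N - 1)%N -> lead_coef (jpoly K n) = r n].
Proof.
move=> HJ OJ r2.
(* The sign is the ratio of the wanted leading coefficient to that of J; [minn] freezes it from N -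
   1 on, as [s_const] requires. *)
pose s n := if minn n (N - 1) is m.+1 then r m.+1 / lead_coef (jpoly J m.+1) else 1.
have s0 : s 0 = 1 by rewrite /s min0n.
have s2 n : s n ^+ 2 = 1.
  rewrite /s; case mE: (minn n _) => [|m]; first by rewrite expr1n.
  rewrite expr_div_n r2; last by lia.
  by rewrite -expr_div_n divff ?expr1n ?lead_jpoly_neq0.
have s_const n : (N <= n.+1)%N -> s n.+1 = s n.
  by move=> Nn; rewrite /s !(minn_idPr _) //; lia.
exists (sign_conj s J); split; first exact: sign_conj_jacobi.
  exact: sign_conj_gsf.
move=> [//|n] nN; rewrite jpoly_sign_conj // lead_coefZ /s (minn_idPl _); last by lia.
by rewrite divfK // lead_jpoly_neq0.
Qed.

End Gsf.

(** * Counting the matrices and prescribing square roots *)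

Lemma card_eq_finType (T : finType) : [set: T] #= `I_#|T|.
Proof.
rewrite (card_eqr card_II).
have <- : (@enum_rank T) @` setT = setT.
  rewrite eqEsubset; split=> // k _; exists (enum_val k) => //.
  exact: enum_valK.
by rewrite card_eq_sym; apply: inj_card_eq => x y _ _; exact: enum_rank_inj.
Qed.

Theorem mainTheorem4 (R : realType) (N : nat)
    (Omega : {scalar {poly_(N.*2.+1) R[i]}}) :
  (0 < N)%N ->
  (exists J : 'M[R[i]]_N, is_jacobi J /\ is_gsf J Omega) ->
  [set J : 'M[R[i]]_N | is_jacobi J /\ is_gsf J Omega] #= `I_(2 ^ (N - 1))
  /\
  (exists alpha2 : nat -> R[i],
    (forall J : 'M[R[i]]_N, is_jacobi J -> is_gsf J Omega ->
       forall n : nat, (1 <= n <= N - 1)%N ->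
         lead_coef (jpoly J n) ^+ 2 = alpha2 n)
    /\
    (* root n true and root n false are the square roots labelled + and - *)
    (forall root : nat -> bool -> R[i],
       (forall n : nat, (1 <= n <= N - 1)%N ->
          root n true != root n false /\
          (forall z : R[i],
             z ^+ 2 = alpha2 n <-> z = root n true \/ z = root n false)) ->
       forall sigma : nat -> bool,
       exists! J : 'M[R[i]]_N,
         [/\ is_jacobi J,
             is_gsf J Omega
           & forall n : nat, (1 <= n <= N - 1)%N ->
               lead_coef (jpoly J n) = root n (sigma n)])).
Proof.
move=> N0 [J [HJ OJ]].
pose l n := lead_coef (jpoly J n).
have ltN n : (1 <= n <= N - 1)%N -> (n < N)%N.
  by lia.
have l0 n : l n != 0 by exact: lead_jpoly_neq0.
split; last first.
  exists (fun n => l n ^+ 2); split.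
    by move=> K HK OK n /ltN nN; exact: (gsf_lead_sqr HJ OJ HK OK nN).
  move=> root rootP sigma.
  have [|K [HK OK leadK]] := gsf_lead_exists (r := fun n => root n (sigma n)) HJ OJ.
    by move=> n /rootP[_ ->]; case: sigma; [left|right].
  exists K; split=> // K' [HK' OK' leadK']; apply: (gsf_lead_inj HK OK) => // n nN.
  by rewrite leadK ?leadK'.
set S := [set _ | _].
(* Relative to the fixed J, a matrix is coded by its N - 1 signs, the bit k belonging to P_(k+1). *)
pose g (K : 'M[R[i]]_N) : {ffun 'I_(N - 1) -> bool} :=
  [ffun k : 'I_(N - 1) => lead_coef (jpoly K k.+1) == l k.+1].
have gS : g @` S = setT.
  rewrite eqEsubset; split=> // e _.
  (* The default [false] is reached only outside 1 <= n <= N - 1, where nothing is prescribed. *)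
  pose r n := if oapp e false (insub n.-1) then l n else - l n.
  have [n _|K [HK OK leadK]] := gsf_lead_exists (r := r) HJ OJ.
    by rewrite /r; case: ifP => _; rewrite ?sqrrN.
  exists K => //; apply/ffunP => k; rewrite ffunE leadK ?ltn_ord // /r /= valK /=.
  by case: (e k); rewrite ?eqxx // eqNr (negPf (l0 _)).
have g_inj : {in S &, injective g}.
  move=> K K'; rewrite !inE => -[HK OK] [HK' OK'] eqg.
  apply: (gsf_lead_inj HK OK) => // n nN; have nN' := ltN n nN.
  (* Both leading coefficients are l n or -l n; with equal bits, both are l n or both are -l n. *)
  have /eqP := gsf_lead_sqr HJ OJ HK OK nN'.
  have /eqP := gsf_lead_sqr HJ OJ HK' OK' nN'.
  case: n nN {nN'} => // n nN.
  have /ffunP/(_ (Ordinal nN)) := eqg; rewrite !ffunE /= -/(l _) !eqf_sqr.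
  by case: eqP => [->|_]; case: eqP => [->|_] //= _ /eqP-> /eqP->.
rewrite -(card_eql (inj_card_eq g_inj)) gS.
have := card_eq_finType {ffun 'I_(N - 1) -> bool}.
by rewrite card_ffun card_bool card_ord.
Qed.
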